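(* If $(\Phi_t)$ is a KMS-symmetric quantum Markov semigroup on $M_n(\mathbb C)$ with generator $\mathcal L$, then there exist matrices $V_1,\dots,V_N\in M_n(\mathbb C)$ such that $\{V_j\}_{j=1}^N=\{V_j^\ast\}_{j=1}^N$ and $$\langle A,\mathcal L(B)\rangle_\rho=\sum_{j=1}^N\langle[V_j,A],[V_j,B]\rangle_\rho$$ for all $A,B\in M_n(\mathbb C)$.
   Context: Fix an invertible density matrix $\rho\in M_n(\mathbb C)$ (positive, trace $1$). The KMS inner product is $\langle A,B\rangle_\rho=\mathrm{tr}(A^\ast\rho^{1/2}B\rho^{1/2})$. A linear map on $M_n(\mathbb C)$ is KMS-symmetric if it is self-adjoint with respect to $\langle\cdot,\cdot\rangle_\rho$. $[V,A]=VA-AV$. A quantum Markov semigroup on $M_n(\mathbb C)$ is a family $(\Phi_t)_{t\ge0}$ of unital completely positive maps on $M_n(\mathbb C)$ with $\Phi_0=\mathrm{id}$, $\Phi_s\Phi_t=\Phi_{s+t}$ for all $s,t\ge0$, and $\lim_{t\to0}\|\Phi_t-\mathrm{id}\|=0$. Its generator is $\mathcal L=\lim_{t\to0}\frac1t(\mathrm{id}-\Phi_t)$, so $\Phi_t=e^{-t\mathcal L}$. It is KMS-symmetric if every $\Phi_t$ is KMS-symmetric. *)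

(* Defs.v *)
From HB Require Import structures.
From mathcomp Require Import all_boot all_order all_algebra.
From mathcomp Require Import sesquilinear spectral complex.
From mathcomp Require Import all_classical all_reals all_analysis.

Set Implicit Arguments.
Unset Strict Implicit.
Unset Printing Implicit Defensive.

Import Order.TTheory GRing.Theory Num.Theory.
Import numFieldNormedType.Exports.

Local Open Scope classical_set_scope.
Local Open Scope sesquilinear_scope.
Local Open Scope complex_scope.
Local Open Scope ring_scope.

Section Positivity.
Variable R : realType.

(* In the order of [R[i]], [0 <= z] says that [z] is real and nonnegative, so
   this implies that [A] is Hermitian. *)
Definition posmx n (A : 'M[R[i]]_n) : Prop :=
  forall v : 'cV[R[i]]_n, 0 <= (v^t* *m A *m v) 0 0.

Definition invertible_density n (rho : 'M[R[i]]_n) : Prop :=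
  [/\ posmx rho, \tr rho = 1 & rho \in unitmx].

(* The positive square root of a positive matrix, by functional calculus. *)
Definition sqrtmx n (A : 'M[R[i]]_n) : 'M[R[i]]_n :=
  invmx (spectralmx A) *m diag_mx (map_mx sqrtC (spectral_diag A))
    *m spectralmx A.

(* The map [id (x) f] on [M_m (M_n)], matrices in [M_m (M_n)] being identified
   with block matrices. *)
Definition ampliation n (f : 'M[R[i]]_n -> 'M[R[i]]_n) m
    (X : 'M[R[i]]_(\sum_(i < m) n)) : 'M[R[i]]_(\sum_(i < m) n) :=
  \mxblock_(i < m, j < m) f (submxblock X i j).

Definition completely_positive n (f : 'M[R[i]]_n -> 'M[R[i]]_n) : Prop :=
  forall m (X : 'M[R[i]]_(\sum_(i < m) n)), posmx X -> posmx (ampliation f X).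

End Positivity.

Section KMS.
Variables (R : realType) (n : nat) (rho : 'M[R[i]]_n).

Definition kms (A B : 'M[R[i]]_n) : R[i] :=
  \tr (A^t* *m sqrtmx rho *m B *m sqrtmx rho).

Definition kms_symmetric (f : 'M[R[i]]_n -> 'M[R[i]]_n) : Prop :=
  forall A B, kms (f A) B = kms A (f B).

End KMS.

Definition commutator (R : realType) n (V A : 'M[R[i]]_n) : 'M[R[i]]_n :=
  V *m A - A *m V.

Section Semigroup.
Variables (R : realType) (n : nat).

(* [F t] tends to [G] in operator norm as [t] decreases to [0]: the bound says
   that the norm of [F t - G] is at most [e].  The norm on matrices is the
   library's (largest modulus of an entry); all choices are equivalent. *)
Definition opnorm_cvg0 (F : R -> 'M[R[i]]_n -> 'M[R[i]]_n)
    (G : 'M[R[i]]_n -> 'M[R[i]]_n) : Prop :=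
  forall e : R, 0 < e -> \forall t \near 0^'+,
    forall A, `|F t A - G A| <= e%:C * `|A|.

(* The parameter is a nonnegative real; the values of [Phi] at negative reals
   are unconstrained. *)
Record quantum_markov_semigroup
    (Phi : R -> {linear 'M[R[i]]_n -> 'M[R[i]]_n}) : Prop := {
  qms_unital : forall t, 0 <= t -> Phi t 1%:M = 1%:M;
  qms_cp : forall t, 0 <= t -> completely_positive (Phi t);
  qms0 : forall A, Phi 0 A = A;
  qmsD : forall s t, 0 <= s -> 0 <= t -> forall A,
    Phi (s + t) A = Phi s (Phi t A);
  qms_cvg : opnorm_cvg0 Phi id }.

Definition kms_symmetric_semigroup (rho : 'M[R[i]]_n)
    (Phi : R -> {linear 'M[R[i]]_n -> 'M[R[i]]_n}) : Prop :=
  forall t, 0 <= t -> kms_symmetric rho (Phi t).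

Definition is_generator (Phi : R -> {linear 'M[R[i]]_n -> 'M[R[i]]_n})
    (L : {linear 'M[R[i]]_n -> 'M[R[i]]_n}) : Prop :=
  opnorm_cvg0 (fun t A => t^-1%:C *: (A - Phi t A)) L.

End Semigroup.

(* Main.v *)
Require Import Defs.
From HB Require Import structures.
From mathcomp Require Import all_boot all_order all_algebra.
From mathcomp Require Import sesquilinear spectral complex ring lra.
From mathcomp Require Import all_classical all_reals all_analysis.
Import Order.TTheory GRing.Theory Num.Theory.
Import numFieldNormedType.Exports.
Set Implicit Arguments.
Unset Strict Implicit.
Unset Printing Implicit Defensive.

(** Write [s] for the square root of [rho].  For a family [V] closed under
    adjoints put [T Z = \sum_j V_j Z adj(V_j) = \sum_j adj(V_j) Z V_j].  Expanding
    the commutators gives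

      [\sum_j <[V_j, A], [V_j, B]> = tr (adj(A) (T(s) B s + s B T(s)
                                               - T(s B) s - s T(B s)))],

    so, up to terms [X B + B adj(X)], the theorem asks for a completely positive
    [T] with [s^-1 T(s B) + T(B s) s^-1 = - L(B)].  In an eigenbasis of [rho],
    with [s = diag(d)], this equation is solved entry by entry: the Choi matrix
    of [T] is that of [- L], divided entrywise by [d_k / d_i + d_l / d_j].

    Positivity.  As a limit of [(id - Phi_t) / t] with [Phi_t] completely
    positive, [- L] has a Choi matrix which is nonnegative on the [x] of trace
    zero.  Dividing by [y_a + y_b] preserves this
    ([hform_cauchy_ge0]), since the Cauchy kernel is positive and since
    [d_k / d_k = 1] makes the trace condition insensitive to rescalings that
    depend on [y] only.  Projecting along the identity matrix
    ([hform_project_ge0]) makes the Choi matrix nonnegative everywhere and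
    changes [T] only by [M Z + Z adj(M)].  The spectral theorem then yields
    matrices [W] with [T Z = \sum W Z adj(W)] ([hform_decomp]).

    Closure under adjoints.  KMS symmetry of [L] says that the Choi matrix of
    [T] is conjugated when both index pairs are swapped, that is
    [\sum W Z adj(W) = \sum adj(W) Z W]; hence the [W / sqrt 2] and their
    adjoints together form a family [V] as above.

    The leftover.  The two sides of the claim now differ by
    [F(A, B) = tr (adj(A) (Y B s + s B adj(Y)))] for some [Y].  Both sides are
    Hermitian forms vanishing when [A] or [B] is the identity, and this
    already forces [F = 0] ([derivation_form_eq0]): there is no
    Hamiltonian part. *)

Local Open Scope sesquilinear_scope.
Local Open Scope ring_scope.

(** * Adjoints and sesquilinear forms over a finite index set *)

Section Forms.
Variable C : numClosedFieldType.

Definition hform (I : finType) (psi : I -> I -> C) (x : I -> C) : C :=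
  \sum_a \sum_b (x a)^* * psi a b * x b.

Lemma sum_pair (I J : finType) (F : I * J -> C) :
  \sum_a F a = \sum_i \sum_j F (i, j).
Proof. by rewrite pair_bigA /=; apply: eq_bigr => -[]. Qed.

Lemma adjE m p (A : 'M[C]_(m, p)) i j : (A ^t*) i j = (A j i)^*.
Proof. by rewrite !mxE. Qed.

Lemma adjM m p q (A : 'M[C]_(m, p)) (B : 'M[C]_(p, q)) :
  (A *m B)^t* = B^t* *m A^t*.
Proof. by rewrite trmx_mul map_mxM. Qed.

Lemma adjD m p (A B : 'M[C]_(m, p)) : (A + B)^t* = A^t* + B^t*.
Proof. by apply/matrixP=> i j; rewrite !mxE rmorphD. Qed.

Lemma adjB m p (A B : 'M[C]_(m, p)) : (A - B)^t* = A^t* - B^t*.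
Proof. by apply/matrixP=> i j; rewrite !mxE rmorphB. Qed.

Lemma adj_sum m p (J : finType) (F : J -> 'M[C]_(m, p)) :
  (\sum_j F j)^t* = \sum_j (F j)^t*.
Proof.
apply/matrixP=> i j; rewrite adjE !summxE rmorph_sum.
by apply: eq_bigr => k _; rewrite adjE.
Qed.

Lemma adjZ m p c (A : 'M[C]_(m, p)) : (c *: A)^t* = c^* *: A^t*.
Proof. by apply/matrixP=> i j; rewrite !mxE rmorphM. Qed.

Lemma mxform_sum n (A : 'M[C]_n) (v : 'cV[C]_n) :
  (v^t* *m A *m v) 0 0 = hform (fun i j => A i j) (fun i => v i 0).
Proof.
rewrite /hform exchange_big mxE; apply: eq_bigr => j _.
by rewrite mxE big_distrl /=; apply: eq_bigr => i _; rewrite adjE.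
Qed.

(** Polarization: a form with real values on the vectors [e_a + c e_b],
    [c = 1] and [c = 'i], has conjugate off-diagonal coefficients. *)
Lemma hermitian_of_psd n (A : 'M[C]_n) :
  (forall v : 'cV[C]_n, 0 <= (v^t* *m A *m v) 0 0) -> A^t* = A.
Proof.
move=> posA; apply/matrixP=> b a; rewrite adjE.
pose e (i : 'I_n) : 'cV[C]_n := delta_mx i 0.
have eAe i j : ((e i)^t* *m A *m e j) 0 0 = A i j.
  rewrite trmx_delta map_delta_mx -mulmxA -colE.
  by rewrite -rowE !mxE.
have real_comb c : A a a + c * A a b + c^* * A b a + c^* * c * A b b \is Num.real.
  have addE (M N : 'M[C]_1) : (M + N) 0 0 = M 0 0 + N 0 0 by rewrite mxE.
  have scaleE k (M : 'M[C]_1) : (k *: M) 0 0 = k * M 0 0 by rewrite mxE.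
  have := ger0_real (posA (e a + c *: e b)).
  rewrite adjD adjZ !(mulmxDl, mulmxDr) -!scalemxAl -!scalemxAr.
  by rewrite !(addE, scaleE) !eAe; congr (_ \is _); ring.
have real_diag c : A c c \is Num.real.
  by rewrite -eAe; apply/ger0_real/posA.
have r1 : A a b + A b a \is Num.real.
  have := real_comb 1; rewrite rmorph1 !mul1r => H.
  have : _ - A a a - A b b \is Num.real := rpredB (rpredB H (real_diag a)) (real_diag b).
  by congr (_ \is _); ring.
have ri : 'i * (A a b - A b a) \is Num.real.
  have := real_comb 'i; rewrite conjCi => H.
  have : _ - A a a - A b b \is Num.real := rpredB (rpredB H (real_diag a)) (real_diag b).
  congr (_ \is _); have ii : 'i * 'i = -1 :> C by rewrite -expr2 sqrCi.
  ring: ii.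
move: r1 ri => /CrealP + /CrealP; rewrite rmorphM rmorphD rmorphB /= conjCi => h1.
rewrite mulNr -mulrN => /(mulfI (neq0Ci C)) h2.
have : (A a b)^* *+ 2 = A b a *+ 2.
  move/(congr1 -%R): h2; rewrite opprK => h2.
  have := congr2 +%R h1 h2; rewrite /= addrACA subrr addr0.
  by rewrite mulr2n => ->; ring.
by move/eqP; rewrite eqrMn2r // => /eqP.
Qed.

(** * Cauchy multipliers preserve positivity *)

(** The Schur complement of the Cauchy kernel at the node [c] is the Cauchy
    kernel itself, rescaled by [(a - c) / (a + c)]; this turns positivity of
    the kernel into an induction on the number of nodes. *)
Lemma cauchy_kernel_pivot (a b c : C) : 0 < a -> 0 < b -> 0 < c ->
  (a + b)^-1 = 2 * c * ((a + c)^-1 * (b + c)^-1)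
   + (a - c) / (a + c) * ((b - c) / (b + c)) * (a + b)^-1.
Proof.
move=> a0 b0 c0; field.
by rewrite !gt_eqF ?addr_gt0.
Qed.

Lemma hformZ (I : finType) c (psi : I -> I -> C) x :
  hform (fun a b => c * psi a b) x = c * hform psi x.
Proof.
rewrite /hform mulr_sumr; apply: eq_bigr => a _; rewrite mulr_sumr.
by apply: eq_bigr => b _; ring.
Qed.

(** Pivoting at a node [y e] splits the form into a nonnegative multiple of
    [psi] at a rescaled vector and the same Cauchy form at a vector whose entry
    at [e] has been killed.  Both vectors are obtained from [x] by multiplying
    with functions of [y], so positivity of [psi] is needed only on a class [S]
    stable under such multiplications. *)
Lemma hform_cauchy_ge0 (I : finType) (y : I -> C) (psi : I -> I -> C)
    (S : (I -> C) -> Prop) :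
  (forall a, 0 < y a) ->
  (forall x g, S x -> S (fun a => g (y a) * x a)) ->
  (forall x, S x -> 0 <= hform psi x) ->
  forall x, S x -> 0 <= hform (fun a b => psi a b / (y a + y b)) x.
Proof.
move=> y0 SM posS x.
move: {2}(#|[set a | x a != 0]|) (leqnn #|[set a | x a != 0]|) => k.
elim: k x => [|k IH] x supp Sx.
  have x0 a : x a = 0.
    move: supp; rewrite leqn0 cards_eq0 => /eqP/setP/(_ a).
    by rewrite !inE => /negbFE/eqP.
  by rewrite /hform big1 // => a _; rewrite big1 // => b _; rewrite (x0 b) mulr0.
case: (pickP (fun a => x a != 0)) => [e xe0|x0]; last first.
  rewrite /hform big1 // => a _; rewrite big1 // => b _.
  by have /negbFE/eqP-> := x0 b; rewrite mulr0.
pose c := y e; have c0 : 0 < c by apply: y0.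
pose x1 a := (y a + c)^-1 * x a.
pose x2 a := (y a - c) / (y a + c) * x a.
have yr a : (y a)^* = y a by apply/CrealP/gtr0_real.
have cr : c^* = c by apply: yr.
have -> : hform (fun a b => psi a b / (y a + y b)) x =
   2 * c * hform psi x1 + hform (fun a b => psi a b / (y a + y b)) x2.
  rewrite -hformZ /hform -big_split; apply: eq_bigr => a _.
  rewrite -big_split; apply: eq_bigr => b _ /=.
  rewrite /x1 /x2 [in LHS](cauchy_kernel_pivot (y0 a) (y0 b) c0).
  by rewrite !(rmorphM, fmorphV, rmorphB, rmorphD) /= yr cr; ring.
apply: addr_ge0.
  apply: mulr_ge0; first by rewrite mulr_ge0 ?ler0n ?ltW.
  exact/posS/(SM _ (fun z => (z + c)^-1)).
apply: IH; last exact: (SM _ (fun z => (z - c) / (z + c))).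
rewrite -ltnS; apply: leq_trans supp; apply/proper_card/properP; split.
  apply/fintype.subsetP => a; rewrite !inE; apply: contra => /eqP xa0.
  by rewrite /x2 xa0 mulr0.
by exists e; rewrite !inE ?negbK // /x2 subrr !mul0r.
Qed.

(** * Sums of squares *)

Lemma psd_spectral n (A : 'M[C]_n) :
  (forall v : 'cV[C]_n, 0 <= (v^t* *m A *m v) 0 0) ->
  A = (spectralmx A)^t* *m diag_mx (spectral_diag A) *m spectralmx A /\
  forall i, 0 <= spectral_diag A 0 i.
Proof.
move=> posA.
have /orthomx_spectralP spec : A \is normalmx.
  by apply/normalmxP; rewrite (hermitian_of_psd posA).
have unit := spectral_unitarymx A; rewrite (invmx_unitary unit) in spec.
split=> //; move: (spectralmx A) (spectral_diag A) spec unit => U d spec unit m.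
have := posA (U^t* *m delta_mx m 0); rewrite spec adjM trmxCK.
rewrite -!mulmxA (mulmxA U) (unitarymxP unit) mul1mx (mulmxA U).
rewrite (unitarymxP unit) mul1mx.
rewrite trmx_delta map_delta_mx mulmxA -rowE -colE.
by rewrite !mxE eqxx mulr1n.
Qed.

Lemma psd_matrix_decomp n (A : 'M[C]_n) :
  (forall v : 'cV[C]_n, 0 <= (v^t* *m A *m v) 0 0) ->
  exists w : 'I_n -> 'I_n -> C, forall i j, A i j = \sum_m w m i * (w m j)^*.
Proof.
case/psd_spectral; move: (spectralmx A) (spectral_diag A) => U d spec d0.
exists (fun m i => sqrtC (d 0 m) * (U m i)^*) => i j.
rewrite spec mxE; apply: eq_bigr => m _.
rewrite mul_mx_diag !mxE rmorphM /= conjCK.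
have -> : (sqrtC (d 0 m))^* = sqrtC (d 0 m).
  by apply/CrealP/ger0_real; rewrite sqrtC_ge0.
rewrite -{1}(sqrtCK (d 0 m)); ring.
Qed.

(** Kraus operators are read off from this, applied to a Choi matrix. *)
Lemma hform_decomp (I : finType) (psi : I -> I -> C) :
  (forall x, 0 <= hform psi x) ->
  exists N (w : 'I_N -> I -> C),
    forall a b, psi a b = \sum_m w m a * (w m b)^*.
Proof.
move=> pos.
pose A : 'M[C]_#|I| := \matrix_(i, j) psi (enum_val i) (enum_val j).
have reindex_enum F : \sum_a F a = \sum_(i < #|I|) F (enum_val i) :> C.
  exact/reindex/onW_bij/enum_val_bij.
have [v|w wE] := @psd_matrix_decomp _ A.
  rewrite mxform_sum.
  suff -> : hform (fun i j => A i j) (fun i => v i 0) =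
            hform psi (fun a => v (enum_rank a) 0) by apply: pos.
  rewrite /hform reindex_enum; apply: eq_bigr => i _.
  by rewrite reindex_enum; apply: eq_bigr => j _; rewrite !enum_valK mxE.
exists #|I|, (fun m a => w m (enum_rank a)) => a b.
by rewrite -wE mxE !enum_rankK.
Qed.

(** * Making a conditionally positive form positive *)

(** The correction [m] for which [t a b + d a * (m b)^* + m a * d b] is the
    compression of [t] by the projection [x |-> x - (\sum_a d a * x a) u].  The
    doubly projected term is split evenly between [m] and its conjugate. *)
Definition trace_shift (I : finType) (t : I -> I -> C) (d u : I -> C) (a : I) :=
  - (\sum_b t a b * u b) + d a * (hform t u / 2).

Lemma conjC_hform (I : finType) (t : I -> I -> C) x :
  (forall a b, t b a = (t a b)^*) -> (hform t x)^* = hform t x.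
Proof.
move=> th; rewrite /hform rmorph_sum exchange_big /=; apply: eq_bigr => a _.
rewrite rmorph_sum; apply: eq_bigr => b _.
by rewrite !rmorphM /= conjCK -th; ring.
Qed.

(** The corrected form at [x] is [t] at the projection of [x] onto the
    hyperplane orthogonal to [d], where [t] is nonnegative. *)
Lemma hform_project_ge0 (I : finType) (t : I -> I -> C) (d u : I -> C) :
  (forall a b, t b a = (t a b)^*) -> (forall a, (d a)^* = d a) ->
  \sum_a d a * u a = 1 ->
  (forall x, \sum_a d a * x a = 0 -> 0 <= hform t x) ->
  let m := trace_shift t d u in
  forall x, 0 <= hform (fun a b => t a b + d a * (m b)^* + m a * d b) x.
Proof.
move=> th dr du pos m x; pose c := \sum_a d a * x a.
have cE : c^* = \sum_a d a * (x a)^*.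
  by rewrite rmorph_sum; apply: eq_bigr => a _; rewrite rmorphM /= dr.
suff -> : hform (fun a b => t a b + d a * (m b)^* + m a * d b) x =
          hform t (fun a => x a - c * u a).
  apply: pos; under eq_bigr do rewrite mulrBr mulrCA.
  by rewrite sumrB -mulr_sumr du mulr1 subrr.
pose tu a := \sum_b t a b * u b.
have tur a : (tu a)^* = \sum_b (u b)^* * t b a.
  by rewrite rmorph_sum; apply: eq_bigr => b _; rewrite rmorphM /= -th mulrC.
have huE : hform t u = \sum_a (u a)^* * tu a.
  apply: eq_bigr => a _; rewrite mulr_sumr; apply: eq_bigr => b _; ring.
have -> : hform (fun a b => t a b + d a * (m b)^* + m a * d b) x =
   hform t x + c^* * (\sum_b (m b)^* * x b) + (\sum_a (x a)^* * m a) * c.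
  rewrite cE /c !big_distrlr /= /hform -!big_split; apply: eq_bigr => a _ /=.
  rewrite -!big_split; apply: eq_bigr => b _ /=; ring.
have -> : hform t (fun a => x a - c * u a) =
   hform t x - c * (\sum_a (x a)^* * tu a) - c^* * (\sum_b (tu b)^* * x b)
    + c * c^* * hform t u.
  have -> : \sum_b (tu b)^* * x b = \sum_a \sum_b (u a)^* * t a b * x b.
    rewrite exchange_big; apply: eq_bigr => b _ /=.
    by rewrite tur mulr_suml.
  have -> : \sum_a (x a)^* * tu a = \sum_a \sum_b (x a)^* * t a b * u b.
    by apply: eq_bigr => a _; rewrite mulr_sumr; apply: eq_bigr => b _; ring.
  rewrite /hform !mulr_sumr -!sumrB -big_split; apply: eq_bigr => a _ /=.
  rewrite !mulr_sumr -!sumrB -big_split; apply: eq_bigr => b _ /=.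
  by rewrite rmorphB rmorphM /=; ring.
have hr := conjC_hform u th.
have hr2 : (hform t u / 2)^* = hform t u / 2.
  by rewrite rmorphM fmorphV /= hr conjC_nat.
have -> : \sum_b (m b)^* * x b =
    - \sum_b (tu b)^* * x b + c * (hform t u / 2).
  rewrite /c mulr_suml -sumrN -big_split; apply: eq_bigr => b _ /=.
  rewrite /m /trace_shift -/(tu b) rmorphD rmorphN rmorphM /= hr2 dr; ring.
have -> : \sum_a (x a)^* * m a =
    - \sum_b (x b)^* * tu b + c^* * (hform t u / 2).
  rewrite cE mulr_suml -sumrN -big_split; apply: eq_bigr => b _ /=.
  rewrite /m /trace_shift -/(tu b); ring.
by field.
Qed.

(** * Weighted inner products and sums of commutators *)

Lemma trace_adj_eq0 n (Z : 'M[C]_n) :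
  (forall A : 'M[C]_n, \tr (A^t* *m Z) = 0) -> Z = 0.
Proof.
move=> H; apply/matrixP=> i j; rewrite [RHS]mxE -(H (delta_mx i j)).
rewrite trmx_delta map_delta_mx /mxtrace (bigD1 j) //= big1 ?addr0 => [|k kj].
  rewrite mxE (bigD1 i) //= big1 ?addr0 => [|l li]; rewrite !mxE.
    by rewrite !eqxx mul1r.
  by rewrite (negPf li) andbF mul0r.
rewrite mxE big1 // => l _; rewrite !mxE.
by rewrite (negPf kj) mul0r.
Qed.

Lemma mulmx3E m n p r (X : 'M[C]_(m, n)) (Y : 'M[C]_(n, p)) (Z : 'M[C]_(p, r)) i j :
  (X *m Y *m Z) i j = \sum_k \sum_l X i k * Y k l * Z l j.
Proof.
rewrite mxE exchange_big; apply: eq_bigr => q _ /=.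
by rewrite mxE mulr_suml.
Qed.

Lemma trace_adj n (A : 'M[C]_n) : \tr (A^t*) = (\tr A)^*.
Proof. by rewrite rmorph_sum; apply: eq_bigr => i _; rewrite adjE. Qed.

(** The KMS inner product with [s] in place of the square root of the density;
    in an eigenbasis of the density [s] is diagonal. *)
Definition weighted_inner n (s A B : 'M[C]_n) : C :=
  \tr (A^t* *m s *m B *m s).

Lemma weighted_inner_conj n (s A B : 'M[C]_n) : s^t* = s ->
  weighted_inner s A B = (weighted_inner s B A)^*.
Proof.
move=> sh; rewrite /weighted_inner -trace_adj !adjM trmxCK sh.
by rewrite mxtrace_mulC !mulmxA.
Qed.

Lemma weighted_inner_unitary_conj n (U s A B : 'M[C]_n) :
  weighted_inner (U^t* *m s *m U) A B =
  weighted_inner s (U *m A *m U^t*) (U *m B *m U^t*).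
Proof.
rewrite /weighted_inner !adjM trmxCK.
by rewrite !mulmxA [LHS]mxtrace_mulC !mulmxA.
Qed.

Lemma weighted_innerZBr n (s A B B' : 'M[C]_n) c :
  weighted_inner s A (c *: (B - B')) =
  c * (weighted_inner s A B - weighted_inner s A B').
Proof.
by rewrite /weighted_inner -scalemxAr -scalemxAl mxtraceZ mulmxBr mulmxBl raddfB.
Qed.

Lemma weighted_innerZBl n (s A A' B : 'M[C]_n) c :
  weighted_inner s (c *: (A - A')) B =
  c^* * (weighted_inner s A B - weighted_inner s A' B).
Proof.
rewrite /weighted_inner adjZ adjB -!scalemxAl mxtraceZ.
by rewrite !mulmxBl raddfB.
Qed.

Local Notation comm V A := (V *m A - A *m V).

(** Each of the four terms of a product of two commutators brings [V j] and its
    adjoint to the two sides of one matrix; the two hypotheses let both orders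
    be summed to the same map [T]. *)
Lemma sum_commutator_inner n (s : 'M[C]_n) N (V : 'I_N -> 'M[C]_n)
    (T : 'M[C]_n -> 'M[C]_n) :
  (forall Z, \sum_j V j *m Z *m (V j)^t* = T Z) ->
  (forall Z, \sum_j (V j)^t* *m Z *m V j = T Z) ->
  forall A B,
  \sum_j weighted_inner s (comm (V j) A) (comm (V j) B) =
  \tr (A^t* *m (T s *m B *m s + s *m B *m T s
                 - T (s *m B) *m s - s *m T (B *m s))).
Proof.
move=> TV TVs A B.
have -> : T s *m B *m s + s *m B *m T s - T (s *m B) *m s - s *m T (B *m s) =
  \sum_j ((V j)^t* *m s *m V j *m B *m s + s *m B *m (V j *m s *m (V j)^t*)
    - (V j)^t* *m (s *m B) *m V j *m s
    - s *m (V j *m (B *m s) *m (V j)^t*)).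
  by rewrite !sumrB big_split /= -!mulmx_suml -!mulmx_sumr !TV !TVs.
rewrite mulmx_sumr raddf_sum /=.
apply: eq_bigr => j _; rewrite /weighted_inner.
move: (V j) => W.
rewrite adjB !adjM !(mulmxBl, mulmxBr, mulmxDl, mulmxDr, mulmxN, mulNmx, opprK, raddfD, raddfN) /=.
rewrite (_ : \tr (W^t* *m A^t* *m s *m (W *m B) *m s) =
  \tr (A^t* *m (s *m (W *m (B *m s) *m W^t*)))); last first.
  by rewrite -!mulmxA mxtrace_mulC !mulmxA.
rewrite (_ : \tr (W^t* *m A^t* *m s *m (B *m W) *m s) =
  \tr (A^t* *m (s *m B *m (W *m s *m W^t*)))); last first.
  by rewrite -!mulmxA mxtrace_mulC !mulmxA.
rewrite !mulmxA; ring.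
Qed.

(** Eliminating [Y^t*] between the two equations shows that [Y] commutes with
    the square of [diag_mx d], hence with [diag_mx d] since [d] is positive. *)
Lemma skew_adj_comm_diag n (d : 'rV[C]_n) (Y : 'M[C]_n) :
  (forall i, 0 < d 0 i) ->
  diag_mx d *m Y + Y^t* *m diag_mx d = 0 ->
  Y *m diag_mx d + diag_mx d *m Y^t* = 0 ->
  Y^t* = - Y /\ diag_mx d *m Y = Y *m diag_mx d.
Proof.
move=> d0 /matrixP h1 /matrixP h2.
have key i j : d 0 i * Y i j = Y i j * d 0 j /\ (Y j i)^* = - Y i j.
  move: (h1 i j) (h2 i j).
  rewrite !(mul_diag_mx, mul_mx_diag) !mxE.
  set z := (Y j i)^*; set w := Y i j; set p := d 0 i; set q := d 0 j => e1 e2.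
  have p0 : 0 < p by apply: d0.
  have q0 : 0 < q by apply: d0.
  have pq : p + q != 0 by rewrite gt_eqF ?addr_gt0.
  have e3 : p * w = w * q.
    apply/eqP; rewrite -subr_eq0 -(mulrI_eq0 _ (mulfI pq)).
    have -> : (p + q) * (p * w - w * q) =
       p * (p * w + z * q) - q * (w * q + p * z) by ring.
    by rewrite e1 e2 !mulr0 subrr.
  split=> //.
  apply: (mulIf (lt0r_neq0 q0)); apply/eqP; rewrite -subr_eq0; apply/eqP.
  rewrite -[RHS]e1 e3; ring.
split; apply/matrixP=> i j; first by rewrite adjE mxE; have [] := key i j.
by rewrite mul_diag_mx mul_mx_diag !mxE; have [] := key i j.
Qed.

(** Vanishing at the identity in either argument makes [Y] skew-adjoint and
    commuting with [s].  Then [F A B = \tr (A^t* *m (Y *m B *m s - s *m B *m Y))]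
    is skew-Hermitian, so being Hermitian as well it is zero. *)
Lemma derivation_form_eq0 n (d : 'rV[C]_n) (Y : 'M[C]_n)
  (s := diag_mx d)
  (F := fun A B => \tr (A^t* *m (Y *m B *m s + s *m B *m Y^t*))) :
  (forall i, 0 < d 0 i) ->
  (forall A, F A 1%:M = 0) -> (forall B, F 1%:M B = 0) ->
  (forall A B, F A B = (F B A)^*) -> forall A B, F A B = 0.
Proof.
move=> d0 FA1 F1B Fh A B.
have sh : s^t* = s.
  apply/matrixP=> i j; rewrite adjE !mxE eq_sym.
  have dr : (d 0 i)^* = d 0 i by apply/CrealP/gtr0_real.
  case: eqP => [->|_]; rewrite ?mulr1n ?mulr0n ?rmorph0 //.
  by apply/CrealP/gtr0_real.
have [|| Ya sY] := @skew_adj_comm_diag n d Y d0.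
- rewrite -/s; apply: trace_adj_eq0 => D; rewrite -[RHS](F1B (D^t*)) /F.
  rewrite trmx1 map_mx1 mul1mx mulmxDr !raddfD /=; congr (_ + _).
    by rewrite mulmxA mxtrace_mulC mulmxA.
  by rewrite mulmxA mxtrace_mulC mulmxA.
- rewrite -/s; apply: trace_adj_eq0 => D; rewrite -[RHS](FA1 D) /F.
  by rewrite !mulmx1.
have: F A B = - F A B.
  rewrite {1}Fh /F -/s -trace_adj adjM adjD !adjM !trmxCK Ya sh.
  rewrite !(mulmxDr, mulmxDl, mulmxN, mulNmx, raddfD, raddfN) /= opprK.
  have -> : \tr (A^t* *m (Y *m B *m s)) = \tr (s *m (A^t* *m Y) *m B).
    by rewrite !mulmxA mxtrace_mulC !mulmxA.
  by congr (_ + _); rewrite -!mulmxA mxtrace_mulC !mulmxA.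
move/eqP; rewrite -subr_eq0 opprK -mulr2n mulrn_eq0 /= => /eqP//.
Qed.

(** * The theorem in an eigenbasis of the density *)

Section Diagonal.
Variables (n : nat) (d : 'rV[C]_n) (L : {linear 'M[C]_n -> 'M[C]_n}).
Let s := diag_mx d.
Let I := ('I_n * 'I_n)%type.
Hypotheses (n_gt0 : (0 < n)%N) (d_gt0 : forall i, 0 < d 0 i).
Hypothesis Lsym : forall A B,
  weighted_inner s (L A) B = weighted_inner s A (L B).
Hypothesis L1 : L 1%:M = 0.
Hypothesis Ladj : forall A, L (A^t*) = (L A)^t*.

(** Index pairs are ordered (column, row) of a Kraus operator: the entry at
    [(k, i), (l, j)] of [Z |-> W *m Z *m W^t*] is [W i k * (W j l)^*]. *)
Definition choi (f : 'M[C]_n -> 'M[C]_n) (a b : I) : C :=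
  f (delta_mx a.1 b.1) a.2 b.2.

Hypothesis Lccn : forall x : I -> C, \sum_k x (k, k) = 0 -> hform (choi L) x <= 0.

(* [T_choi] solves [s^-1 T(s B) + T(B s) s^-1 = - L B] entrywise; [T0_choi] is its
   compression off the identity matrix, [unitv] being the identity divided by
   [n] so that it has trace one. *)
Let ratio (a : I) := d 0 a.1 / d 0 a.2.
Let T_choi (a b : I) := - choi L a b / (ratio a + ratio b).
Let on_diag (a : I) : C := (a.1 == a.2)%:R.
Let unitv (a : I) : C := on_diag a / n%:R.
Let shift := trace_shift T_choi on_diag unitv.
Let T0_choi (a b : I) := T_choi a b + on_diag a * (shift b)^* + shift a * on_diag b.

Definition map_of_choi (k : I -> I -> C) (B : 'M[C]_n) : 'M[C]_n :=
  \matrix_(i, j) \sum_p \sum_q B p q * k (p, i) (q, j).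

Lemma conj_d i : (d 0 i)^* = d 0 i.
Proof. exact/CrealP/gtr0_real. Qed.

Lemma d_neq0 i : d 0 i != 0. Proof. by rewrite gt_eqF. Qed.

Lemma diag_adj : s^t* = s.
Proof.
apply/matrixP=> i j; rewrite adjE !mxE eq_sym.
by case: eqP => [->|_]; rewrite ?mulr1n ?mulr0n ?rmorph0 ?conj_d.
Qed.

Lemma ratio_gt0 a : 0 < ratio a. Proof. exact: divr_gt0. Qed.

Lemma conj_ratio a : (ratio a)^* = ratio a. Proof. exact/CrealP/gtr0_real/ratio_gt0. Qed.

Lemma choi_herm a b : choi L b a = (choi L a b)^*.
Proof. by rewrite /choi -adjE -Ladj trmx_delta map_delta_mx. Qed.

Lemma T_choi_herm a b : T_choi b a = (T_choi a b)^*.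
Proof.
by rewrite /T_choi rmorphM fmorphV rmorphN rmorphD /= !conj_ratio -choi_herm addrC.
Qed.

Definition swap (a : I) : I := (a.2, a.1).

Lemma weighted_delta (A : 'M[C]_n) k l :
  weighted_inner s A (delta_mx k l) = d 0 k * d 0 l * (A k l)^*.
Proof.
rewrite /weighted_inner /s mul_mx_diag /mxtrace (bigD1 l) //= big1 => [|j jl].
  rewrite !mxE (bigD1 k) //= big1 ?addr0 => [|p pk]; rewrite mul_mx_diag !mxE.
    rewrite !eqxx mulr1 ?addr0; ring.
  by rewrite (negPf pk) mulr0.
rewrite !mxE big1 ?mul0r // => p _.
by rewrite !mxE (negPf jl) andbF mulr0.
Qed.

(** KMS symmetry of [L], tested on matrix units. *)
Lemma choi_swap a b :
  d 0 a.2 * d 0 b.2 * (choi L a b)^* = d 0 a.1 * d 0 b.1 * choi L (swap a) (swap b).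
Proof.
rewrite -weighted_delta Lsym (weighted_inner_conj _ _ diag_adj) weighted_delta.
by rewrite !rmorphM /= !conj_d conjCK.
Qed.

(** The weights of [choi_swap] are exactly absorbed by the denominators, since
    swapping an index inverts its ratio: [T] is symmetric for the unweighted
    trace pairing. *)
Lemma T_choi_swap a b : T_choi (swap a) (swap b) = (T_choi a b)^*.
Proof.
rewrite /T_choi rmorphM fmorphV rmorphN rmorphD /= !conj_ratio /ratio /=.
have <- : d 0 a.2 * d 0 b.2 * (choi L a b)^* / (d 0 a.1 * d 0 b.1) =
   choi L (swap a) (swap b).
  rewrite choi_swap; field; by rewrite !d_neq0.
field; rewrite !d_neq0 /= !gt_eqF // ?addr_gt0 ?mulr_gt0 //.
Qed.

Lemma on_diag_swap a : on_diag (swap a) = on_diag a. Proof. by rewrite /on_diag /= eq_sym. Qed.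
Lemma conj_on_diag a : (on_diag a)^* = on_diag a. Proof. by rewrite conjC_nat. Qed.
Lemma conj_unitv a : (unitv a)^* = unitv a.
Proof. by rewrite /unitv rmorphM fmorphV /= conj_on_diag conjC_nat. Qed.

Lemma sum_swap (F : I -> C) : \sum_a F a = \sum_a F (swap a).
Proof. by apply: reindex_inj => -[a b] [a' b'] [-> ->]. Qed.

Lemma shift_swap a : shift (swap a) = (shift a)^*.
Proof.
rewrite /shift /trace_shift rmorphD rmorphN !rmorphM fmorphV /= (conjC_hform _ T_choi_herm).
rewrite on_diag_swap conj_on_diag conjC_nat; congr (- _ + _).
rewrite sum_swap rmorph_sum; apply: eq_bigr => b _.
by rewrite T_choi_swap rmorphM /= conj_unitv /unitv on_diag_swap.
Qed.

Lemma T0_choi_swap a b : T0_choi (swap a) (swap b) = (T0_choi a b)^*.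
Proof.
rewrite /T0_choi T_choi_swap !shift_swap !on_diag_swap.
rewrite -{1}[on_diag a]conj_on_diag -{1}[on_diag b]conj_on_diag.
by move: (T_choi a b) (shift a) (shift b) (on_diag a) (on_diag b) => ? ? ? ? ?; rewrite !rmorphD !rmorphM.
Qed.

Lemma sum_on_diag (F : I -> C) : \sum_a on_diag a * F a = \sum_k F (k, k).
Proof.
rewrite sum_pair; apply: eq_bigr => i _.
rewrite (bigD1 i) //= big1 ?addr0 /on_diag /= ?eqxx ?mul1r // => j ji.
by rewrite eq_sym (negPf ji) mul0r.
Qed.

(** On the diagonal indices the ratio is 1, so multiplying a vector of trace zero
    by a function of the ratio keeps its trace zero; this is what lets
    [hform_cauchy_ge0] be applied to a conditionally positive form. *)
Lemma T0_choi_ge0 x : 0 <= hform T0_choi x.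
Proof.
apply: hform_project_ge0; [exact: T_choi_herm|exact: conj_on_diag| |].
  rewrite sum_on_diag; under eq_bigr do rewrite /unitv /on_diag eqxx.
  have nn : n%:R != 0 :> C by rewrite pnatr_eq0 -lt0n.
  by rewrite sumr_const card_ord -[_ *+ n]mulr_natl mulrCA mulfV ?mulr1.
move=> z; rewrite sum_on_diag => z0.
apply: (@hform_cauchy_ge0 _ ratio (fun a b => - choi L a b)
  (fun z => \sum_k z (k, k) = 0)) => //; first exact: ratio_gt0.
  move=> {}z {z0} g z0; transitivity (g 1 * \sum_k z (k, k)); last by rewrite z0 mulr0.
  rewrite mulr_sumr; apply: eq_bigr => k _.
  by rewrite /ratio divff ?d_neq0.
move=> x' /Lccn; rewrite -oppr_ge0; congr (_ <= _).
rewrite /hform -sumrN; apply: eq_bigr => a _; rewrite -sumrN.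
by apply: eq_bigr => b _; ring.
Qed.

Let shift_mx : 'M[C]_n := \matrix_(i, k) shift (k, i).

Lemma map_of_T0_choi B : map_of_choi T0_choi B = map_of_choi T_choi B + shift_mx *m B + B *m shift_mx^t*.
Proof.
apply/matrixP=> i j; rewrite !mxE -addrA.
have delta (F : 'I_n -> C) q : \sum_p F p * (p == q)%:R = F q.
  rewrite (bigD1 q) //= big1 ?addr0 ?eqxx ?mulr1 // => p /negPf->.
  by rewrite mulr0.
have -> : \sum_p shift_mx i p * B p j =
    \sum_p \sum_q B p q * (shift (p, i) * on_diag (q, j)).
  apply: eq_bigr => p _; rewrite mxE -(delta (B p) j) mulr_sumr.
  by apply: eq_bigr => q _; rewrite /on_diag /=; ring.
have -> : \sum_q B i q * (shift_mx^t*) q j =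
    \sum_p \sum_q B p q * (on_diag (p, i) * (shift (q, j))^*).
  rewrite exchange_big /=; apply: eq_bigr => q _.
  rewrite adjE mxE -(delta (fun p => B p q) i) mulr_suml.
  by apply: eq_bigr => p _; rewrite /on_diag /=; ring.
rewrite -!big_split; apply: eq_bigr => p _ /=.
rewrite -!big_split; apply: eq_bigr => q _ /=.
rewrite /T0_choi; ring.
Qed.

Lemma generator_from_T B :
  s *m L B *m s = - (map_of_choi T_choi (s *m B) *m s + s *m map_of_choi T_choi (B *m s)).
Proof.
apply/matrixP=> i j; rewrite /s !(mul_mx_diag, mul_diag_mx) !mxE.
have -> : L B i j = \sum_p \sum_q B p q * L (delta_mx p q) i j.
  rewrite {1}(matrix_sum_delta B) linear_sum summxE; apply: eq_bigr => p _.
  rewrite linear_sum summxE; apply: eq_bigr => q _.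
  by rewrite linearZ mxE.
rewrite !(mulr_sumr, mulr_suml) -big_split -sumrN; apply: eq_bigr => p _.
rewrite !(mulr_sumr, mulr_suml) -big_split -sumrN; apply: eq_bigr => q _ /=.
rewrite !mxE /T_choi /choi /ratio /=.
field.
by rewrite !d_neq0 /= gt_eqF // addr_gt0 // mulr_gt0.
Qed.

Theorem diagonal_commutator_form : exists N (V : 'I_N -> 'M[C]_n),
  (forall j, exists j', V j' = (V j)^t*) /\
  forall A B, weighted_inner s A (L B) =
    \sum_j weighted_inner s (V j *m A - A *m V j) (V j *m B - B *m V j).
Proof.
have [N [w wE]] := hform_decomp T0_choi_ge0.
pose W k : 'M[C]_n := \matrix_(i, p) w k (p, i).
have T0W Z : map_of_choi T0_choi Z = \sum_k W k *m Z *m (W k)^t*.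
  apply/matrixP=> i j; rewrite summxE mxE.
  under [RHS]eq_bigr do rewrite mulmx3E.
  rewrite [RHS]exchange_big; apply: eq_bigr => p _ /=.
  rewrite [RHS]exchange_big; apply: eq_bigr => q _ /=.
  rewrite wE mulr_sumr; apply: eq_bigr => k _.
  by rewrite adjE !mxE; ring.
(* This is where the symmetry of [T] enters. *)
have T0W' Z : map_of_choi T0_choi Z = \sum_k (W k)^t* *m Z *m W k.
  apply/matrixP=> i j; rewrite summxE mxE.
  under [RHS]eq_bigr do rewrite mulmx3E.
  rewrite [RHS]exchange_big; apply: eq_bigr => p _ /=.
  rewrite [RHS]exchange_big; apply: eq_bigr => q _ /=.
  have -> : T0_choi (p, i) (q, j) = (T0_choi (i, p) (j, q))^* by rewrite -T0_choi_swap.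
  rewrite wE rmorph_sum mulr_sumr; apply: eq_bigr => k _ /=.
  by rewrite adjE rmorphM /= conjCK !mxE; ring.
pose r : C := sqrtC 2^-1.
have rr : r^* = r by apply/CrealP/ger0_real; rewrite sqrtC_ge0 invr_ge0 ler0n.
have r2 : r * r = 2^-1 by rewrite -expr2 sqrtCK.
pose V (j : 'I_(N + N)) := match fintype.split j with
  | inl k => r *: W k | inr k => r *: (W k)^t* end.
have VW (F : 'M[C]_n -> 'M[C]_n) :
    \sum_j F (V j) = \sum_k (F (r *: W k) + F (r *: (W k)^t*)).
  rewrite big_split_ord big_split /=; congr (_ + _); apply: eq_bigr => k _.
    by rewrite /V (unsplitK (inl k)).
  by rewrite /V (unsplitK (inr k)).
have half (X : 'M[C]_n) : (r * r) *: (X + X) = X.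
  by rewrite r2 scalerDr -scalerDl (_ : _ + _ = 1) ?scale1r //; field.
have TV Z : \sum_j V j *m Z *m (V j)^t* = map_of_choi T0_choi Z.
  rewrite (VW (fun X => X *m Z *m X^t*)) -[RHS]half {1}T0W T0W' -big_split.
  rewrite scaler_sumr; apply: eq_bigr => k _ /=.
  by rewrite !adjZ trmxCK rr -!scalemxAl -!scalemxAr !scalerA scalerDr.
have TV' Z : \sum_j (V j)^t* *m Z *m V j = map_of_choi T0_choi Z.
  rewrite (VW (fun X => X^t* *m Z *m X)) -[RHS]half {1}T0W' T0W -big_split.
  rewrite scaler_sumr; apply: eq_bigr => k _ /=.
  by rewrite !adjZ trmxCK rr -!scalemxAl -!scalemxAr !scalerA scalerDr.
exists (N + N)%N, V; split.
  move=> j; rewrite /V; case: (fintype.split j) => k.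
    by exists (unsplit (inr k)); rewrite unsplitK adjZ rr.
  by exists (unsplit (inl k)); rewrite unsplitK adjZ rr trmxCK.
move=> A B; apply/eqP; rewrite eq_sym -subr_eq0; apply/eqP.
(* The map of [T0_choi] exceeds that of [T_choi] by
   [Z |-> shift_mx *m Z + Z *m shift_mx^t*]; this excess and the terms in which
   [s] itself is mapped combine into [Y]. *)
pose Y := map_of_choi T0_choi s - shift_mx *m s - s *m shift_mx.
have T0s : (map_of_choi T0_choi s)^t* = map_of_choi T0_choi s.
  rewrite T0W; apply/matrixP=> i j; rewrite adjE !summxE rmorph_sum.
  by apply: eq_bigr => k _ /=; rewrite -adjE !adjM trmxCK diag_adj mulmxA.
have FE A1 B1 :
    \sum_j weighted_inner s (V j *m A1 - A1 *m V j) (V j *m B1 - B1 *m V j)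
    - weighted_inner s A1 (L B1)
    = \tr (A1^t* *m (Y *m B1 *m s + s *m B1 *m Y^t*)).
  rewrite (sum_commutator_inner s TV TV') /weighted_inner.
  have -> : A1^t* *m s *m L B1 *m s = A1^t* *m (s *m L B1 *m s).
    by rewrite !mulmxA.
  rewrite generator_from_T -raddfB /= -mulmxBr.
  congr (\tr (_ *m _)).
  rewrite /Y !adjB T0s !adjM diag_adj [map_of_choi T0_choi (s *m B1)]map_of_T0_choi.
  rewrite [map_of_choi T0_choi (B1 *m s)]map_of_T0_choi.
  rewrite !(mulmxDr, mulmxDl, mulmxN, mulNmx) !mulmxA.
  apply/matrixP=> i j; have addE (P Q : 'M[C]_n) : (P + Q) i j = P i j + Q i j.
    by rewrite mxE.
  have oppE (P : 'M[C]_n) : (- P) i j = - P i j by rewrite mxE.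
  by rewrite !(addE, oppE); ring.
rewrite FE; apply: derivation_form_eq0 => // [A1|B1|A1 B1]; rewrite -!FE.
- rewrite L1 /weighted_inner !(mulmx0, mul0mx) raddf0 subr0 big1 // => j _.
  by rewrite mulmx1 mul1mx subrr !(mulmx0, mul0mx) raddf0.
- rewrite -Lsym L1 /weighted_inner trmx0 map_mx0 !(mulmx0, mul0mx) raddf0 subr0 big1 // => j _.
  by rewrite mulmx1 mul1mx subrr trmx0 map_mx0 !(mulmx0, mul0mx) raddf0.
- rewrite rmorphB rmorph_sum /= -(weighted_inner_conj _ _ diag_adj) Lsym; congr (_ - _).
  by apply: eq_bigr => j _; rewrite -(weighted_inner_conj _ _ diag_adj).
Qed.
End Diagonal.
End Forms.

Local Open Scope classical_set_scope.
Local Open Scope sesquilinear_scope.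
Local Open Scope complex_scope.
Local Open Scope ring_scope.

(** * Passing to the generator *)

Lemma entry_le_norm (K : numDomainType) m p (A : 'M[K]_(m, p)) i j :
  `|A i j| <= `|A|.
Proof.
change (`|A i j| <= mx_norm A); rewrite mx_normE -[leLHS]nngE num_le.
exact: (le_bigmax _ _ (i, j)).
Qed.

Section Limits.
Variables (R : realType).
Local Notation C := R[i].

(** In [R[i]] being at most 0 also means being real, so the imaginary part has to
    be controlled along with the real part. *)
Lemma le0_of_approx (K z : C) : 0 <= K ->
  (forall e : R, 0 < e -> exists2 w : C, w <= 0 & `|w - z| <= K * e%:C) ->
  z <= 0.
Proof.
move=> K0 H.
have [k k0 KE] : exists2 k : R, 0 <= k & K = k%:C.
  have /complex_realP[k KE] := ger0_real K0.
  by exists k => //; rewrite -ler0c -KE.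
have {}H (e : R) : 0 < e -> exists2 w : C, w <= 0 & `|w - z| <= e%:C.
  move=> e0; have k1 : 0 < k + 1 by rewrite ltr_wpDl.
  have [w w0 wz] := H (e / (k + 1)) (divr_gt0 e0 k1).
  exists w => //; apply: le_trans wz _; rewrite KE -rmorphM lecR.
  rewrite mulrCA ler_piMr ?(ltW e0) // ler_pdivrMr // mul1r lerDl //.
have bound (e : R) : 0 < e -> complex.Re z <= e /\ `|complex.Im z| <= e.
  move=> /H[[wr wi]]; rewrite lecE /= => /andP[/eqP wi0 wr0] wz.
  have reb (x : C) : `|complex.Re x| <= e \/ ~~ (`|x| <= e%:C).
    case: (boolP (`|x| <= e%:C)) => xe; [left|by right].
    by rewrite -lecR; apply: le_trans xe; apply: normc_ge_Re.
  case: (reb (Complex wr wi - z)) => [hr|]; last by rewrite wz.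
  have wzi : `|(Complex wr wi - z) * 'i%C| <= e%:C.
    by rewrite normrM [`|'i%C|]normc_def /= expr0n /= add0r expr1n sqrtr1 mulr1.
  case: (reb ((Complex wr wi - z) * 'i%C)) => [hi|]; last by rewrite wzi.
  move: hi hr {H reb wz wzi}; case: z => zr zi /=.
  rewrite -wi0 /= => hi hr; split; last first.
    by move: hi; rewrite mulr0 mulr1 !sub0r opprK.
  by move: hr; rewrite ler_norml => /andP[h _]; lra.
rewrite lecE /=; apply/andP; split.
  rewrite eq_sym -normr_le0; apply/ler_addgt0Pl => e e0.
  by rewrite addr0; have [] := bound e e0.
by apply/ler_addgt0Pl => e e0; rewrite addr0; have [] := bound e e0.
Qed.

Variable n : nat.
Local Notation Mn := 'M[C]_n.
Implicit Types (f g : Mn -> Mn) (q : (Mn -> Mn) -> C).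

Definition within (e : C) f g := forall A : Mn, `|f A - g A| <= e * `|A|.

(** The functionals through which properties of the difference quotients pass to
    the generator.  Being Lipschitz for the operator norm is closed under all
    the operations needed, complex conjugation included, so that also
    conjugate-linear expressions are covered. *)
Definition lipschitz_functional q := exists2 K : C, 0 <= K &
  forall (e : C) f g, 0 <= e -> within e f g -> `|q f - q g| <= K * e.

Lemma lipschitz_entry A i j : lipschitz_functional (fun f => f A i j).
Proof.
exists `|A| => // e f g e0 fg; rewrite mulrC; apply: le_trans (fg A).
by apply: le_trans (entry_le_norm _ i j); rewrite !mxE.
Qed.

Lemma lipschitzZ c q : lipschitz_functional q ->
  lipschitz_functional (fun f => c * q f).
Proof.
case=> K K0 qK; exists (`|c| * K); first exact: mulr_ge0.
move=> e f g e0 /(qK _ _ _ e0) fg.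
by rewrite -mulrBr normrM -mulrA ler_wpM2l.
Qed.

Lemma lipschitzD q1 q2 : lipschitz_functional q1 -> lipschitz_functional q2 ->
  lipschitz_functional (fun f => q1 f + q2 f).
Proof.
case=> K1 K10 q1K [K2 K20 q2K]; exists (K1 + K2); first exact: addr_ge0.
move=> e f g e0 fg; rewrite opprD addrACA mulrDl.
by apply: le_trans (ler_normD _ _) _; rewrite lerD ?q1K ?q2K.
Qed.

Lemma lipschitzN q : lipschitz_functional q ->
  lipschitz_functional (fun f => - q f).
Proof.
case=> K K0 qK; exists K => // e f g e0 fg.
by rewrite -opprD normrN; apply: qK.
Qed.

Lemma lipschitz_conj q : lipschitz_functional q ->
  lipschitz_functional (fun f => Num.conj (q f)).
Proof.
case=> K K0 qK; exists K => // e f g e0 fg.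
by rewrite -rmorphB norm_conjC; apply: qK.
Qed.

Lemma lipschitz_sum (J : finType) (q : J -> (Mn -> Mn) -> C) :
  (forall j, lipschitz_functional (q j)) ->
  lipschitz_functional (fun f => \sum_j q j f).
Proof.
move=> qL; have H (r : seq J) : lipschitz_functional (fun f => \sum_(j <- r) q j f).
  elim: r => [|j r IH].
    by exists 0 => // e f g e0 fg; rewrite !big_nil subrr normr0 mul0r.
  have [K K0 KP] := lipschitzD (qL j) IH.
  by exists K => // e f g e0 fg; rewrite !big_cons; apply: KP.
exact: H.
Qed.

Lemma eq_lipschitz q1 q2 : q1 =1 q2 ->
  lipschitz_functional q1 -> lipschitz_functional q2.
Proof.
by move=> q12 [K K0 KP]; exists K => // e f g e0 fg; rewrite -!q12; apply: KP.
Qed.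

Lemma lipschitz_sandwich m p (X : 'M[C]_(m, n)) (Y : 'M[C]_(n, p)) A i j :
  lipschitz_functional (fun f => (X *m f A *m Y) i j).
Proof.
apply: (@eq_lipschitz (fun f => \sum_k \sum_l (X i k * Y l j) * f A k l)).
  move=> f; rewrite mulmx3E; apply: eq_bigr => k _; apply: eq_bigr => l _.
  by rewrite mulrAC.
by do 2!apply: lipschitz_sum => ?; apply/lipschitzZ/lipschitz_entry.
Qed.

Variables (Phi : R -> {linear Mn -> Mn}) (L : {linear Mn -> Mn}).
Hypothesis genL : is_generator Phi L.

Definition difference_quotient (t : R) (A : Mn) : Mn := t^-1%:C *: (A - Phi t A).

Lemma generator_le0 q : lipschitz_functional q ->
  (forall t, 0 < t -> q (difference_quotient t) <= 0) -> q L <= 0.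
Proof.
case=> K K0 qK qle0; apply: (le0_of_approx K0) => e e0.
have [t [t0 tP]] : exists t, 0 < t /\ within e%:C (difference_quotient t) L.
  apply: (@filter_ex _ (0 : R)^'+).
  near=> t; split; first by near: t; apply: nbhs_right_gt.
  by near: t; apply: genL.
exists (q (difference_quotient t)); first exact: qle0.
by apply: qK => //; rewrite ler0c ltW.
Unshelve. all: by end_near.
Qed.

Lemma generator_eq0 q : lipschitz_functional q ->
  (forall t, 0 < t -> q (difference_quotient t) = 0) -> q L = 0.
Proof.
move=> ql q0; apply: le_anti; rewrite generator_le0 //=; last first.
  by move=> t t0; rewrite q0.
rewrite -oppr_le0; apply: (@generator_le0 (fun f => - q f)).
  exact: lipschitzN.
by move=> t t0; rewrite q0 // oppr0.
Qed.
End Limits.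

(** * Consequences of complete positivity *)

Section CompletelyPositive.
Variables (R : realType) (n : nat).
Local Notation C := R[i].
Local Notation Mn := 'M[C]_n.

Lemma adj_mxcol m p (B : 'I_m -> 'M[C]_(n, p)) :
  (\mxcol_(i < m) B i)^t* = \mxrow_(i < m) (B i)^t*.
Proof. by apply/matrixP=> i j; rewrite !mxE. Qed.

Lemma dot_ge0 p (z : 'cV[C]_p) : 0 <= (z^t* *m z) 0 0.
Proof.
by rewrite mxE sumr_ge0 // => i _; rewrite adjE mulrC mul_conjC_ge0.
Qed.

Lemma posmx_gram m (u : 'I_m -> 'cV[C]_n) :
  posmx (\mxblock_(k < m, l < m) (u k *m (u l)^t*)).
Proof.
move=> v; rewrite -mul_mxcol_mxrow -adj_mxcol mulmxA -mulmxA.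
by rewrite -{1}(trmxCK (\mxcol_i u i)) -adjM dot_ge0.
Qed.

(** The ampliation of [f], applied to the Gram block matrix of the [u k] and
    tested on the column of the [y k]. *)
Lemma completely_positive_form f m (u y : 'I_m -> 'cV[C]_n) :
  completely_positive f ->
  0 <= \sum_k \sum_l ((y k)^t* *m f (u k *m (u l)^t*) *m y l) 0 0.
Proof.
move=> cpf; have := cpf m _ (posmx_gram u) (\mxcol_i y i).
rewrite /ampliation adj_mxcol mul_mxrow_mxblock mul_mxrow_mxcol.
rewrite summxE exchange_big; congr (_ <= _); apply: eq_bigr => l _ /=.
rewrite mulmx_suml summxE; apply: eq_bigr => k _.
by rewrite mxblockK.
Qed.

(** The Choi block matrix of [f] is positive, hence Hermitian; its blocks are the
    images of the matrix units. *)
Lemma completely_positive_adj (f : {linear Mn -> Mn}) A :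
  completely_positive f -> f (A^t*) = (f A)^t*.
Proof.
move=> cpf; pose e (i : 'I_n) : 'cV[C]_n := delta_mx i 0.
have ee k l : e k *m (e l)^t* = delta_mx k l.
  by rewrite trmx_delta map_delta_mx mul_delta_mx.
have fe k l : (f (delta_mx l k))^t* = f (delta_mx k l).
  have /hermitian_of_psd := cpf n _ (posmx_gram e).
  move/(congr1 (fun X => submxblock X k l)).
  have -> X : submxblock (X^t*) k l = (submxblock X l k)^t*.
    by apply/matrixP=> i j; rewrite !mxE.
  by rewrite /ampliation !mxblockK !ee.
have fsum B : f B = \sum_k \sum_l B k l *: f (delta_mx k l).
  rewrite {1}(matrix_sum_delta B) linear_sum; apply: eq_bigr => k _.
  by rewrite linear_sum; apply: eq_bigr => l _; rewrite linearZ.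
rewrite !fsum adj_sum exchange_big; apply: eq_bigr => k _ /=.
by rewrite adj_sum; apply: eq_bigr => l _; rewrite adjZ fe adjE.
Qed.
End CompletelyPositive.

(** * Properties of the generator *)

Section Generator.
Variables (R : realType) (n : nat) (rho : 'M[R[i]]_n).
Local Notation C := R[i].
Local Notation Mn := 'M[C]_n.
Variables (Phi : R -> {linear Mn -> Mn}) (L : {linear Mn -> Mn}).
Hypotheses (qmsP : quantum_markov_semigroup Phi)
  (symP : kms_symmetric_semigroup rho Phi) (genL : is_generator Phi L).

Lemma generator1 : L 1%:M = 0.
Proof.
apply/matrixP => i j; rewrite [RHS]mxE.
apply: (generator_eq0 genL (lipschitz_entry 1%:M i j)) => t t0.
by rewrite /difference_quotient (qms_unital qmsP (ltW t0)) subrr scaler0 mxE.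
Qed.

Lemma generator_adj A : L (A^t*) = (L A)^t*.
Proof.
apply/matrixP => i j; rewrite adjE; apply/eqP; rewrite -subr_eq0; apply/eqP.
apply: (@generator_eq0 _ _ _ _ genL (fun f => f (A^t*) i j - Num.conj (f A j i))).
  apply: lipschitzD; first exact: lipschitz_entry.
  exact/lipschitzN/lipschitz_conj/lipschitz_entry.
move=> t t0; rewrite -adjE /difference_quotient adjZ adjB.
rewrite (completely_positive_adj _ (qms_cp qmsP (ltW t0))).
rewrite (_ : Num.conj t^-1%:C = t^-1%:C) ?subrr //.
exact: conjc_real.
Qed.

Lemma generator_kms : kms_symmetric rho L.
Proof.
have kmsE X Y : kms rho X Y =
    \sum_i (X^t* *m sqrtmx rho *m Y *m sqrtmx rho) i i by [].
have Lip X Y : lipschitz_functional (fun f : Mn -> Mn => kms rho X (f Y)).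
  apply: lipschitz_sum => i.
  exact: lipschitz_sandwich.
have Lip' X Y : lipschitz_functional (fun f : Mn -> Mn => kms rho (f X) Y).
  apply: (@eq_lipschitz _ _ (fun f : Mn -> Mn => \sum_i Num.conj
    ((((sqrtmx rho *m Y *m sqrtmx rho)^t*) *m f X *m 1%:M) i i))).
    move=> f; rewrite /kms -[RHS]/(\sum_i _); apply: eq_bigr => i _.
    by rewrite -adjE mulmx1 adjM trmxCK !mulmxA.
  by apply: lipschitz_sum => i; apply/lipschitz_conj/lipschitz_sandwich.
move=> A B; apply/eqP; rewrite -subr_eq0; apply/eqP.
apply: (@generator_eq0 _ _ _ _ genL (fun f => kms rho (f A) B - kms rho A (f B))).
  exact/lipschitzD/lipschitzN.
move=> t t0; apply/eqP; rewrite subr_eq0; apply/eqP.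
have tr : Num.conj t^-1%:C = t^-1%:C by apply: conjc_real.
change (weighted_inner (sqrtmx rho) (difference_quotient Phi t A) B =
        weighted_inner (sqrtmx rho) A (difference_quotient Phi t B)).
have sym : weighted_inner (sqrtmx rho) (Phi t A) B =
           weighted_inner (sqrtmx rho) A (Phi t B) := symP (ltW t0) A B.
by rewrite weighted_innerZBl weighted_innerZBr tr sym.
Qed.

(** For [(id - Phi t) / t] the contribution of the identity is [t^-1] times the
    squared norm of [\sum_k (u k)^t* *m y k], which the hypothesis kills; what
    remains is minus a nonnegative number. *)
Lemma generator_conditionally_negative m (u y : 'I_m -> 'cV[C]_n) :
  \sum_k (u k)^t* *m y k = 0 ->
  \sum_k \sum_l ((y k)^t* *m L (u k *m (u l)^t*) *m y l) 0 0 <= 0.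
Proof.
move=> uy0; apply: (@generator_le0 _ _ _ _ genL
  (fun f => \sum_k \sum_l ((y k)^t* *m f (u k *m (u l)^t*) *m y l) 0 0)).
  do 2!apply: lipschitz_sum => ?; exact: lipschitz_sandwich.
move=> t t0.
have -> : \sum_k \sum_l ((y k)^t* *m difference_quotient Phi t (u k *m (u l)^t*) *m y l) 0 0
  = t^-1%:C * (((\sum_k (u k)^t* *m y k)^t* *m (\sum_k (u k)^t* *m y k)) 0 0 -
     \sum_k \sum_l ((y k)^t* *m Phi t (u k *m (u l)^t*) *m y l) 0 0).
  rewrite adj_sum mulmx_suml summxE -sumrB mulr_sumr; apply: eq_bigr => k _.
  rewrite mulmx_sumr summxE -sumrB mulr_sumr; apply: eq_bigr => l _.
  rewrite /difference_quotient -scalemxAr -scalemxAl mulmxBr mulmxBl.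
  rewrite mxE; congr (_ * _); rewrite mxE adjM trmxCK !mulmxA; congr (_ + _).
  by rewrite mxE.
rewrite uy0 mulmx0 mxE sub0r mulrN oppr_le0 mulr_ge0 //.
  by rewrite ler0c invr_ge0 ltW.
exact/completely_positive_form/(qms_cp qmsP (ltW t0)).
Qed.
End Generator.

(** * Reduction to the eigenbasis *)

Lemma invertible_density_size_gt0 (R : realType) n (rho : 'M[R[i]]_n) :
  invertible_density rho -> (0 < n)%N.
Proof.
case: n rho => // rho [_ tr1 _]; move: tr1.
by rewrite /mxtrace big_ord0 => /eqP; rewrite eq_sym oner_eq0.
Qed.

Lemma sqrtmx_diagonalization (R : realType) n (rho : 'M[R[i]]_n) :
  invertible_density rho ->
  exists (U : 'M[R[i]]_n) (d : 'rV[R[i]]_n),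
    [/\ U \is unitarymx, forall i, 0 < d 0 i &
        sqrtmx rho = U^t* *m diag_mx d *m U].
Proof.
case=> [/psd_spectral[spec d0] _ unit].
exists (spectralmx rho), (map_mx sqrtC (spectral_diag rho)).
split; first exact: spectral_unitarymx; last first.
  by rewrite /sqrtmx (invmx_unitary (spectral_unitarymx rho)).
move=> i; rewrite mxE sqrtC_gt0 lt_def d0 andbT.
move: unit; rewrite {1}spec !unitmx_mul => /andP[/andP[_ +] _].
rewrite unitmxE det_diag unitfE => /prodf_neq0; exact.
Qed.

Theorem theorem2p5 (R : realType) (n : nat) (rho : 'M[R[i]]_n)
    (Phi : R -> {linear 'M[R[i]]_n -> 'M[R[i]]_n})
    (L : {linear 'M[R[i]]_n -> 'M[R[i]]_n}) :
  invertible_density rho ->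
  quantum_markov_semigroup Phi ->
  kms_symmetric_semigroup rho Phi ->
  is_generator Phi L ->
  exists (N : nat) (V : 'I_N -> 'M[R[i]]_n),
    [set V j | j in [set: 'I_N]] = [set (V j)^t* | j in [set: 'I_N]] /\
    forall A B : 'M[R[i]]_n,
      kms rho A (L B) =
        \sum_(j < N) kms rho (commutator (V j) A) (commutator (V j) B).
Proof.
move=> rhoP qmsP symP genL.
have n0 := invertible_density_size_gt0 rhoP.
have [U [d [Uu d0 sE]]] := sqrtmx_diagonalization rhoP.
have UV : U *m U^t* = 1%:M by apply/unitarymxP.
have VU : U^t* *m U = 1%:M by apply: mulmx1C.
pose s := diag_mx d.
pose up A := U *m A *m U^t*; pose dn A := U^t* *m A *m U.
have updn A : up (dn A) = A.
  by rewrite /up /dn !mulmxA UV mul1mx -mulmxA UV mulmx1.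
have dnup A : dn (up A) = A.
  by rewrite /up /dn !mulmxA VU mul1mx -mulmxA VU mulmx1.
have upM A B : up (A *m B) = up A *m up B.
  by rewrite /up !mulmxA -(mulmxA (U *m A) _ U) VU mulmx1.
have upB A B : up (A - B) = up A - up B.
  by rewrite /up mulmxBr mulmxBl.
have up_adj A : up (A^t*) = (up A)^t*.
  by rewrite /up !adjM trmxCK mulmxA.
have dn_adj A : dn (A^t*) = (dn A)^t*.
  by rewrite /dn !adjM trmxCK mulmxA.
have kmsE A B : kms rho A B = weighted_inner s (up A) (up B).
  by rewrite -weighted_inner_unitary_conj -sE.
have upZD c A B : up (c *: A + B) = c *: up A + up B.
  by rewrite /up mulmxDr mulmxDl -scalemxAr -scalemxAl.
have dnZD c A B : dn (c *: A + B) = c *: dn A + dn B.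
  by rewrite /dn mulmxDr mulmxDl -scalemxAr -scalemxAl.
have Llin : linear (up \o L \o dn).
  by move=> c A B; rewrite [LHS]/= dnZD linearP upZD.
pose L' : {linear 'M[R[i]]_n -> 'M[R[i]]_n} :=
  HB.pack (up \o L \o dn) (GRing.isLinear.Build _ _ _ _ _ Llin).
have L'E A : L' A = up (L (dn A)) by [].
have L'dn A : L' (up A) = up (L A) by rewrite L'E dnup.
have [| | | |N [V [Vadj VE]]] := @diagonal_commutator_form _ n d L' n0 d0.
- move=> A B; have := generator_kms symP genL (dn A) (dn B).
  by rewrite !kmsE !updn.
- by rewrite -[1%:M]updn L'dn /dn mulmx1 VU (generator1 qmsP genL) /up mulmx0 mul0mx.
- by move=> A; rewrite !L'E dn_adj (generator_adj qmsP genL) up_adj.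
- move=> x x0.
  (* The Choi form of [L'] is the form of [generator_conditionally_negative] at
     the eigenvectors [u k] and the vectors [y k] with coordinates [x (k, _)]. *)
  pose u k : 'cV[R[i]]_n := U^t* *m delta_mx k 0.
  pose z k : 'cV[R[i]]_n := \col_i x (k, i).
  have uu k l : u k *m (u l)^t* = dn (delta_mx k l).
    rewrite /u /dn adjM trmxCK trmx_delta map_delta_mx.
    by rewrite -(mul_delta_mx (0 : 'I_1) k l) !mulmxA.
  have -> : hform (choi L') x =
      \sum_k \sum_l ((U^t* *m z k)^t* *m L (u k *m (u l)^t*) *m (U^t* *m z l)) 0 0.
    rewrite /hform sum_pair; apply: eq_bigr => k _.
    under eq_bigr do rewrite sum_pair.
    rewrite exchange_big; apply: eq_bigr => l _ /=.
    rewrite adjM trmxCK uu mulmxA -(mulmxA _ U) -(mulmxA _ (U *m _)) mulmx3E.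
    apply: eq_bigr => i _; apply: eq_bigr => j _.
    by rewrite adjE !(mxE _ _ _ 0).
  apply: (generator_conditionally_negative qmsP genL).
  apply/matrixP=> a b; rewrite !ord1 summxE [RHS]mxE -[RHS]x0.
  apply: eq_bigr => k _.
  rewrite /u adjM trmxCK -!mulmxA (mulmxA U) UV mul1mx.
  by rewrite trmx_delta map_delta_mx -rowE !mxE.
exists N, (fun j => dn (V j)); split.
  apply/seteqP; split=> _ [j _ <-].
    have [j' Vj'] := Vadj j; exists j' => //.
    by rewrite -dn_adj Vj' trmxCK.
  have [j' Vj'] := Vadj j; exists j' => //.
  by rewrite -dn_adj Vj'.
move=> A B; rewrite kmsE -L'dn VE; apply: eq_bigr => j _.
rewrite kmsE /commutator !upB (upM (dn (V j)) A) (upM A (dn (V j))).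
by rewrite (upM (dn (V j)) B) (upM B (dn (V j))) updn.
Qed.
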